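(* Fix $k\ge2$, and for $r\ge0$ let $N_{21\text{-}3\text{-}\ldots\text{-}k}(x;r)=\sum_{n\ge0}c_{n,r}x^n$, where $c_{n,r}$ is the number of $\pi\in\mathfrak M_n$ containing exactly $r$ occurrences of the generalized pattern $21\text{-}3\text{-}\ldots\text{-}k$. Then $$N_{21\text{-}3\text{-}\ldots\text{-}k}(x;0)=\frac{U_{k-3}\left(\frac{1-x}{2x}\right)-xU_{k-4}\left(\frac{1-x}{2x}\right)}{x\left(U_{k-2}\left(\frac{1-x}{2x}\right)-xU_{k-3}\left(\frac{1-x}{2x}\right)\right)},$$ and for all $r=1,2,\dots,k-1$, $$N_{21\text{-}3\text{-}\ldots\text{-}k}(x;r)=\frac{x^r(1+x)^rU_{k-2}^{\,r-1}\left(\frac{1-x}{2x}\right)}{\left(U_{k-2}\left(\frac{1-x}{2x}\right)-xU_{k-3}\left(\frac{1-x}{2x}\right)\right)^{r+1}}.$$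
   Context: A permutation $\pi=\pi_1\cdots\pi_n$ is a Motzkin permutation if it avoids the pattern $132$ (no $i<j<k$ with $\pi_i<\pi_k<\pi_j$) and there are no indices $a<b$ with $\pi_a<\pi_b<\pi_{b+1}$; $\mathfrak M_n$ is the set of them. An occurrence of $21\text{-}3\text{-}\ldots\text{-}k$ in $\pi$ is a choice of indices $i<i+1<i_3<\dots<i_k$ (first two adjacent) with $\pi_{i+1}<\pi_i<\pi_{i_3}<\dots<\pi_{i_k}$. $U_r$ is the Chebyshev polynomial of the second kind: $U_0(t)=1$, $U_1(t)=2t$, $U_r(t)=2tU_{r-1}(t)-U_{r-2}(t)$ for all integers $r$ (so $U_{-1}=0$, $U_{-2}=-1$). Rational functions are expanded as formal power series in $x$.
   Formalization: Proved for k≥3 instead of k≥2: at k=2 both formulas are false, since for r=0 the right side is 1 while N=1+x+x^2, and for r=1 the right side is x+x^2 while N=x^2+3x^3+2x^4. *)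

(* Defs.v *)
From HB Require Import structures.
From mathcomp Require Import all_boot all_order all_fingroup all_algebra.

Set Implicit Arguments.
Unset Strict Implicit.
Unset Printing Implicit Defensive.

Import GRing.Theory.
Local Open Scope ring_scope.

Section Permutations.
Local Open Scope nat_scope.

Definition avoids132 (n : nat) (s : 'S_n) : bool :=
  ~~ [exists i : 'I_n, exists j : 'I_n, exists l : 'I_n,
       [&& i < j, j < l, s i < s l & s l < s j]].

Definition avoids1_23 (n : nat) (s : 'S_n) : bool :=
  ~~ [exists a : 'I_n, exists b : 'I_n, exists c : 'I_n,
       [&& a < b, c == b.+1 :> nat, s a < s b & s b < s c]].

Definition motzkin_perm (n : nat) (s : 'S_n) : bool :=
  avoids132 s && avoids1_23 s.

(* [t] lists the positions i, i+1 < i_3 < ... < i_k of the letters of a copy of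
   21-3-...-k in [s]; the last conjunct is s_i < s_(i_3) < ... < s_(i_k). *)
Definition occurrence (n : nat) (s : 'S_n) (t : seq 'I_n) : bool :=
  if t is i :: j :: u then
    [&& j == i.+1 :> nat, path ltn j (map val u),
        s j < s i & path ltn (s i) [seq val (s l) | l <- u]]
  else false.

Definition num_occurrences (k n : nat) (s : 'S_n) : nat :=
  #|[set t : k.-tuple 'I_n | occurrence s t]|.

Definition motzkin_count (k n r : nat) : nat :=
  #|[set s : 'S_n | motzkin_perm s && (num_occurrences k s == r)]|.

End Permutations.

Fixpoint chebU_nat (R : nzRingType) (m : nat) : {poly R} :=
  match m with
  | 0 => 1
  | 1 => 'X *+ 2
  | (m1.+1 as m2).+1 => 'X *+ 2 * chebU_nat R m2 - chebU_nat R m1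
  end.

(* Running the recurrence backwards from U_0 and U_1 gives U_(-1) = 0 and
   U_(-m-2) = - U_m; recall that [Negz p] is the integer -(p + 1). *)
Definition chebU (R : nzRingType) (r : int) : {poly R} :=
  match r with
  | Posz m => chebU_nat R m
  | Negz 0 => 0
  | Negz m.+1 => - chebU_nat R m
  end.

Lemma chebU_rec (R : nzRingType) (r : int) :
  chebU R r = 'X *+ 2 * chebU R (r - 1) - chebU R (r - 2).
Proof.
have comX m : chebU_nat R m.+2
    = 'X *+ 2 * chebU_nat R m.+1 - chebU_nat R m by [].
case: r => [[|[|m]]|[|m]].
- by rewrite /= mulr0 sub0r opprK.
- by rewrite /= mulr1 subr0.
- have -> : Posz m.+2 - 1 = Posz m.+1 by rewrite -addn1 PoszD addrK.
  by have -> : Posz m.+2 - 2 = Posz m by rewrite -addn2 PoszD addrK.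
- by rewrite /= mulrN1 opprK addNr.
- have -> : Negz m.+1 - 1 = Negz m.+2.
    by rewrite !NegzE -opprD -PoszD addn1.
  have -> : Negz m.+1 - 2 = Negz m.+3.
    by rewrite !NegzE -opprD -PoszD addn2.
  rewrite [chebU R (Negz m.+3)]/chebU [chebU R (Negz m.+1)]/chebU.
  rewrite [chebU R (Negz m.+2)]/chebU comX mulrN opprK addrA addNr add0r.
  by [].
Qed.

Definition ratfun : fieldType := {fraction {poly rat}}.

(* [F] = P / Q with Q(0) <> 0 and Q * (sum_n c_n x^n) = P as formal power
   series; for a given [F] there is at most one such sequence [c]. *)
Definition series_expansion (F : ratfun) (c : nat -> rat) : Prop :=
  exists P Q : {poly rat},
    [/\ Q`_0 != 0, F = tofrac P / tofrac Q
      & forall n : nat, \sum_(i < n.+1) Q`_i * c (n - i)%N = P`_n].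

Definition ratx : ratfun := tofrac ('X : {poly rat}).

(* U_r((1 - x) / (2 x)) *)
Definition chebUx (r : int) : ratfun :=
  (chebU ratfun r).[(1 - ratx) / (2%:R * ratx)].

(* Main.v *)
(* A nonempty Motzkin permutation is either n t, or s m n t with s > m > t
   letterwise, where n is the largest letter and s, t are again (order isomorphic
   to) Motzkin permutations. Encoding it as the forest with a root over s followed
   by the forest of t, the number of occurrences of 21-3-...-k becomes the sum of
   C(depth, k-2) over all nodes. A node of depth k-1 contributes k-1 and has an
   ancestor of depth k-2 contributing 1, so permutations with r <= k-1
   occurrences have depth at most k-2, and r is the number of nodes of depth k-2.
   Their generating function is therefore the finite continued fraction
   G_0 = 1/(1 - q(x+x^2)), G_(j+1) = 1/(1 - x - x^2 G_j) at j = k-2, whose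
   convergents have denominators D_j - q(x+x^2) V_j with V_j = x^j U_j and
   D_j = V_j - x^2 V_(j-1); the coefficient of q^r follows from
   V_(j+1) D_j - V_j D_(j+1) = x^(2j+2). *)
Require Import Defs.
From HB Require Import structures.
From mathcomp Require Import all_boot all_order all_fingroup all_algebra.
From mathcomp Require Import zify ring.

Import GRing.Theory.
Local Open Scope ring_scope.

(** * Motzkin words *)

Section Words.
Local Open Scope nat_scope.

(* Number of increasing subsequences of length j of w with letters above a. *)
Fixpoint inc (j a : nat) (w : seq nat) : nat :=
  match w, j with
  | _, 0 => 1
  | [::], _ => 0
  | x :: w', j'.+1 => inc j a w' + (a < x) * inc j' x w'
  end.

Arguments inc : simpl never.

(* For j > 0 this counts the occurrences of 21-3-...-(j+2). The last letter also
   counts as a descent top (the default 0 of [head] is never above it), which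
   matters only for j = 0, where it makes the recursion [occ_opUS] uniform. *)
Fixpoint occ (j : nat) (w : seq nat) : nat :=
  if w is x :: w' then occ j w' + (head 0 w' <= x) * inc j x w' else 0.

(** The clauses are grouped by the letter playing the 1: [pairwise] excludes 132 starting at [x];
    [sorted], which tests only neighbours, excludes 1-23. *)
Fixpoint motzkin_word (w : seq nat) : bool :=
  if w is x :: w' then
    [&& motzkin_word w', pairwise (fun b c => ~~ (x < c < b)) w'
      & sorted (fun b c => ~~ (x < b < c)) w']
  else true.

Lemma motzkin_word_cons x w : motzkin_word (x :: w) =
  [&& motzkin_word w, pairwise (fun b c => ~~ (x < c < b)) w
    & sorted (fun b c => ~~ (x < b < c)) w].
Proof. by []. Qed.

Lemma inc0 a w : inc 0 a w = 1.
Proof. by case: w. Qed.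

Lemma incS j a x w : inc j.+1 a (x :: w) = inc j.+1 a w + (a < x) * inc j x w.
Proof. by []. Qed.

Lemma inc_small j a w : all (fun y => y <= a) w -> inc j a w = (j == 0).
Proof.
case: j => [|j]; first by rewrite inc0.
elim: w => //= x w IHw /andP[xa wa].
by rewrite incS IHw // ltnNge xa.
Qed.

Lemma inc_block j a u m n w :
    m <= a < n -> all (fun y => y < n) u -> all (fun y => y <= a) w ->
  inc j.+1 a (u ++ [:: m, n & w]) = inc j.+1 a u + inc j a u.
Proof.
move=> + + wa; elim: u j a wa => [|x u IHu] j a wa man.
  have wn : all (fun y => y <= n) w by apply: sub_all wa => y; lia.
  have -> : inc j a [::] = (j == 0) by apply: inc_small.
  case/andP: man => ma an _.
  by rewrite cat0s !incS an (inc_small j n) // inc_small // ltnNge ma; case: j.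
move=> /= /andP[xn un]; rewrite !incS IHu //.
case: ltnP => ax; last by case: j => [|j]; rewrite ?inc0 ?incS; lia.
case: j => [|j]; first by rewrite !inc0; lia.
have wx : all (fun y => y <= x) w by apply: sub_all wa => y; lia.
by rewrite incS IHu //; lia.
Qed.

(** Behind [u] only [n] exceeds letters of [u], which accounts for [occ j u]; [m] is no descent top,
    and nothing exceeds [n]. *)
Lemma occ_blockS j u m n w :
    m < n -> all (fun y => m < y < n) u -> all (fun y => y < m) w ->
  occ j.+1 (u ++ [:: m, n & w]) = occ j.+1 u + occ j u + occ j.+1 w.
Proof.
move=> mn + wm; elim: u => [_|x u IHu] /=.
  rewrite [n <= m]leqNgt mn (inc_small _ n) ?muln0 ?addn0 //.
  by apply: sub_all wm => y; lia.
move=> /andP[mxn un]; rewrite IHu //.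
(* The last letter of [u] is followed by the smaller [m], hence is a descent top, as the default of
   [head] makes it in [u] alone. *)
have -> : (head 0 (u ++ [:: m, n & w]) <= x) = (head 0 u <= x).
  by case: u {IHu un} => //=; lia.
rewrite inc_block; first by case: (_ <= x); lia.
- by lia.
- by apply: sub_all un => y; lia.
- by apply: sub_all wm => y; lia.
Qed.

Lemma occ_block0 u m n w :
    m < n -> all (fun y => m < y < n) u -> all (fun y => y < m) w ->
  occ 0 (u ++ [:: m, n & w]) = (occ 0 u + occ 0 w).+1.
Proof.
move=> mn + wm; elim: u => [_|x u IHu] /=.
  rewrite [n <= m]leqNgt mn !inc0 /=.
  suff -> : head 0 w <= n by lia.
  by case: w wm => //= y w; lia.
move=> /andP[mxn un]; rewrite IHu // !inc0.
have -> : (head 0 (u ++ [:: m, n & w]) <= x) = (head 0 u <= x).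
  by case: u {IHu un} => //=; lia.
by lia.
Qed.

Lemma pairwise_small (r : rel nat) (P : pred nat) w :
  all P w -> (forall b c, P b -> P c -> r b c) -> pairwise r w.
Proof.
move=> + rP; elim: w => //= x w IHw /andP[Px Pw]; rewrite IHw // andbT.
by apply: sub_all Pw => y; apply: rP.
Qed.

Lemma motzkin_word_top n w : all (fun y => y < n) w -> motzkin_word (n :: w) = motzkin_word w.
Proof.
move=> wn; rewrite motzkin_word_cons (pairwise_small _ _ _ wn); last by move=> b c /=; lia.
rewrite pairwise_sorted ?andbT // (pairwise_small _ _ _ wn) // => b c /=; lia.
Qed.

(** No pattern crosses the blocks: [n], the maximum preceded by [m], is neither the 2 of a 132 nor
    the 3 of a 1-23 that starts in [u], and the letters of [w] are too small to complete either. *)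
Lemma motzkin_word_block u m n w :
    m < n -> all (fun y => m < y < n) u -> all (fun y => y < m) w ->
  motzkin_word (u ++ [:: m, n & w]) = motzkin_word u && motzkin_word w.
Proof.
move=> mn + wm.
have wn : all (fun y => y < n) w by apply: sub_all wm => y; lia.
have pw x : m <= x -> pairwise (fun b c => ~~ (x < c < b)) [:: m, n & w].
  move=> mx; rewrite /= (pairwise_small _ _ _ wm); last by move=> b c /=; lia.
  rewrite (sub_all _ wm) ?(sub_all _ wm) ?andbT; try by move=> y; lia.
  by lia.
have sw x : m <= x -> path (fun b c => ~~ (x < b < c)) m (n :: w).
  move=> mx; rewrite /= ltnNge mx /=.
  have : sorted (fun b c => ~~ (x < b < c)) w.
    by apply/pairwise_sorted/(pairwise_small _ _ _ wm) => b c /=; lia.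
  by case: w wm wn {pw} => //= y w /andP[ym _] /andP[yn _] ->; lia.
elim: u => [_|x u IHu].
  rewrite cat0s -(motzkin_word_top n w) //.
  have := pw m (leqnn m); rewrite pairwise_cons => /andP[_ pm].
  have sm := path_sorted (sw m (leqnn m)).
  by rewrite motzkin_word_cons pm sm !andbT.
move=> /andP[mxn un]; rewrite cat_cons !motzkin_word_cons IHu // pairwise_cat sorted_cat_cons sw; last by lia.
rewrite pw; last by lia.
rewrite (_ : allrel _ _ _); last first.
  apply/allrelP => b c bu; have := allP un _ bu.
  rewrite !inE => ? /or3P[/eqP->|/eqP->|/(allP wm) /=]; lia.
rewrite (_ : sorted _ (rcons u m) = sorted (fun b c => ~~ (x < b < c)) u).
  by rewrite !andbT /= -!andbA; do !bool_congr.
case: u {IHu un} => //= y u; rewrite rcons_path.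
rewrite (_ : ~~ (x < last y u < m)) ?andbT //; lia.
Qed.

Lemma inc_shift c j a w : inc j (c + a) (map (addn c) w) = inc j a w.
Proof.
elim: w j a => [|x w IHw] [|j] a //.
by rewrite map_cons !incS IHw IHw ltn_add2l.
Qed.

Lemma occ_shift c j w : occ j (map (addn c) w) = occ j w.
Proof.
elim: w => //= x w ->; rewrite inc_shift.
by case: w => [|y w] //=; rewrite ?leq_add2l.
Qed.

Lemma motzkin_word_shift c w : motzkin_word (map (addn c) w) = motzkin_word w.
Proof.
elim: w => //= x w ->; rewrite pairwise_map sorted_map; congr [&& _, _ & _].
  by apply: eq_pairwise => b d /=; lia.
by apply: eq_sorted => b d /=; lia.
Qed.

(** * The two building operations *)

Definition is_perm_word (w : seq nat) := perm_eq w (iota 0 (size w)).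

(** The shapes [n t] and [s m n t] with letters numbered from 0: [t] keeps the lowest values, so [m]
    is [size t] and [s] is shifted above it. *)
Definition opH (t : seq nat) := size t :: t.
Definition opU (s t : seq nat) :=
  map (addn (size t).+1) s ++ [:: size t, (size s + size t).+1 & t].

Lemma size_opH t : size (opH t) = (size t).+1.
Proof. by []. Qed.

Lemma size_opU s t : size (opU s t) = (size s + size t).+2.
Proof. by rewrite size_cat size_map /=; lia. Qed.

Lemma is_perm_word_lt w : is_perm_word w -> all (fun y => y < size w) w.
Proof.
move=> ww; apply/allP => y; rewrite (perm_mem ww) mem_iota; lia.
Qed.

Lemma opU_bounds s t : is_perm_word s -> is_perm_word t ->
  [/\ size t < (size s + size t).+1,
      all (fun y => size t < y < (size s + size t).+1) (map (addn (size t).+1) s)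
    & all (fun y => y < size t) t].
Proof.
move=> ss tt; split; [lia | | exact: is_perm_word_lt].
rewrite all_map; apply: sub_all (is_perm_word_lt _ ss) => y /=; lia.
Qed.

Lemma is_perm_word_opH t : is_perm_word t -> is_perm_word (opH t).
Proof.
move=> tt; rewrite /is_perm_word size_opH -addn1 iotaD /opH -[_ :: t]cat1s.
by rewrite perm_catC perm_cat2r.
Qed.

Lemma is_perm_word_opU s t :
  is_perm_word s -> is_perm_word t -> is_perm_word (opU s t).
Proof.
move=> ss tt; rewrite /is_perm_word size_opU.
rewrite (_ : _.+2 = size t + (1 + (size s + 1))); last by lia.
rewrite !iotaD; apply/seq.permP => p.
have := seq.permP (perm_map (addn (size t).+1) ss) p.
rewrite -iotaDl; have := seq.permP tt p.
rewrite /opU !count_cat /= !add0n !addn0 [size t + 1]addn1 addSn [size t + _]addnC.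
by move=> -> ->; lia.
Qed.

Lemma occ_opHS j t : is_perm_word t -> occ j.+1 (opH t) = occ j.+1 t.
Proof.
move=> tt; rewrite /= inc_small ?muln0 ?addn0 //.
by apply: sub_all (is_perm_word_lt _ tt) => y; lia.
Qed.

Lemma occ_opH0 t : is_perm_word t -> occ 0 (opH t) = (occ 0 t).+1.
Proof.
move=> /is_perm_word_lt tt; rewrite /= inc0.
suff -> : head 0 t <= size t by lia.
by case: t tt => //= y t /andP[]; lia.
Qed.

Lemma occ_opUS j s t : is_perm_word s -> is_perm_word t ->
  occ j.+1 (opU s t) = occ j.+1 s + occ j s + occ j.+1 t.
Proof. by move=> ss tt; case: (opU_bounds s t) => // *; rewrite occ_blockS // !occ_shift. Qed.

Lemma occ_opU0 s t : is_perm_word s -> is_perm_word t ->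
  occ 0 (opU s t) = (occ 0 s + occ 0 t).+1.
Proof. by move=> ss tt; case: (opU_bounds s t) => // *; rewrite occ_block0 // occ_shift. Qed.

Lemma motzkin_word_opH t : is_perm_word t -> motzkin_word (opH t) = motzkin_word t.
Proof. by move=> tt; apply/motzkin_word_top/is_perm_word_lt. Qed.

Lemma motzkin_word_opU s t : is_perm_word s -> is_perm_word t ->
  motzkin_word (opU s t) = motzkin_word s && motzkin_word t.
Proof. by move=> ss tt; case: (opU_bounds s t) => // *; rewrite motzkin_word_block // motzkin_word_shift. Qed.

(** * Decomposition at the maximal letter *)

(** The sorted [b] followed by the sorted [a] is sorted, hence is the whole interval; cutting it at
    [size b] gives both claims. *)
Lemma iota_cat_split o a b : perm_eq (a ++ b) (iota o (size a + size b)) ->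
    allrel (fun x y => y < x) a b ->
  perm_eq b (iota o (size b)) /\ perm_eq a (iota (o + size b) (size a)).
Proof.
move=> ab_iota ab.
have e : sort leq b ++ sort leq a = iota o (size b + size a).
  apply: (sorted_eq leq_trans anti_leq).
  - rewrite sorted_pairwise ?pairwise_cat; last exact: leq_trans.
    rewrite -!sorted_pairwise; try exact: leq_trans.
    rewrite !(sort_sorted leq_total) !andbT.
    apply/allrelP => x y; rewrite !mem_sort => xb ya.
    by apply: ltnW; apply: (allrelP ab).
  - exact: iota_sorted.
  - rewrite addnC; apply: perm_trans ab_iota.
    by rewrite perm_sym perm_catC; apply: perm_cat; rewrite perm_sym perm_sort.
move: e; rewrite iotaD => /eqP; rewrite eqseq_cat; last first.
  by rewrite size_sort size_iota.
by case/andP => /eqP<- /eqP<-; rewrite perm_sym perm_sort perm_sym perm_sort.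
Qed.

Lemma motzkin_word_cat_r u w : motzkin_word (u ++ w) -> motzkin_word w.
Proof. by elim: u => //= x u IHu /and3P[/IHu]. Qed.

(* Removing the maximal letter: 132-avoidance puts everything on its left above
   everything on its right, and the letter just before it is the least one on
   its left, since otherwise it would end an ascent forming 1-23. *)
Lemma motzkin_word_cases w : is_perm_word w -> motzkin_word w ->
  [\/ w = [::],
      exists2 t, w = opH t & is_perm_word t /\ motzkin_word t
    | exists s t, w = opU s t /\
        [/\ is_perm_word s, is_perm_word t, motzkin_word s & motzkin_word t]].
Proof.
move=> ww mw; case: (posnP (size w)) => [/size0nil->|w0]; first by constructor 1.
set n := (size w).-1.
have nw : n \in w by rewrite (perm_mem ww) mem_iota /n; lia.
have uw : uniq w by rewrite (perm_uniq ww) iota_uniq.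
have wn y : y \in w -> y != n -> y < n.
  by rewrite (perm_mem ww) mem_iota /n; lia.
have sw : size w = n.+1 by rewrite /n; lia.
clearbody n; move: ww mw {w0} uw wn sw; case/splitPr: nw => u t ww mw uw wn sw.
have tn y : y \in t -> y < n.
  move=> yt; apply: wn; first by rewrite mem_cat inE yt !orbT.
  by apply: contraTneq uw => <-; rewrite cat_uniq /= yt !andbF.
have un y : y \in u -> y < n.
  move=> yt; apply: wn; first by rewrite mem_cat inE yt.
  by apply: contraTneq uw => <-; rewrite cat_uniq /= yt !andbF.
have ut x y : x \in u -> y \in t -> y < x.
  move=> xu yt; move: uw mw; have yn := tn y yt.
  case/splitPr: xu => u1 u2; rewrite -catA cat_cons => uw /motzkin_word_cat_r.
  rewrite motzkin_word_cons pairwise_cat pairwise_cons => /and3P[_ + _].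
  case/and4P=> _ _ /allP/(_ y yt) hxy _; move: uw.
  rewrite cat_uniq /= mem_cat inE => /and3P[_ _ /andP[+ _]].
  case: (ltngtP y x) => // [xy|<-]; last by rewrite yt !orbT.
  by move: hxy; rewrite xy yn.
have ptu : perm_eq (u ++ t) (iota 0 (size u + size t)).
  have := ww; rewrite /is_perm_word sw -addn1 iotaD /= => h.
  move: sw; rewrite size_cat /= addnS => -[->].
  rewrite -(perm_cat2r [:: n]) -catA.
  apply: perm_trans h; rewrite perm_cat2l.
  by rewrite perm_sym -cat1s perm_catC.
case/lastP: u => [|u m] in ww mw uw wn sw un ut ptu *.
  constructor 2; exists t; first by rewrite /opH cat0s; congr (_ :: _); move: sw => /=; lia.
  have pt : is_perm_word t by [].
  by split=> //; have := motzkin_word_cat_r [:: n] t mw.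
have um y : y \in u -> m < y.
  move=> yu; have := mw; have := uw.
  have mn : m < n by apply: un; rewrite mem_rcons inE eqxx.
  rewrite cat_uniq rcons_uniq => /andP[/andP[mu _] _].
  have : y != m by apply: contraNneq mu => <-.
  move: yu => /splitPr[u1 u2]; rewrite cat_rcons -catA cat_cons.
  move=> ? /motzkin_word_cat_r; rewrite motzkin_word_cons sorted_cat_cons => /and3P[_ _ /andP[_]].
  by rewrite /= => /andP[+ _]; lia.
constructor 3.
(* Splitting off [t], then [m], finds their values: [t] is lowest, [m] comes next, and [u] fills the
   interval above. *)
case: (iota_cat_split 0 (rcons u m) t) => //.
- by apply/allrelP => x y; exact: ut.
rewrite add0n size_rcons => pt pum.
have pum' : perm_eq (u ++ [:: m]) (iota (size t) (size u + size [:: m])).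
  by rewrite cats1 addn1.
case: (iota_cat_split (size t) u [:: m]) => //.
- by apply/allrelP => x y xu; rewrite inE => /eqP->; exact: um.
move=> /= pm pu.
have em : m = size t by apply/eqP; rewrite -mem_seq1 -(perm_mem pm) mem_seq1.
pose s := map (subn^~ (size t).+1) u.
have us : u = map (addn (size t).+1) s.
  rewrite /s -map_comp -[LHS]map_id; apply/eq_in_map => y.
  by rewrite (perm_mem pu) mem_iota /=; lia.
have ss : size s = size u by rewrite size_map.
have ps : is_perm_word s.
  rewrite /is_perm_word ss; move: pu; rewrite us size_map ss addn1 -[(size t).+1]addn0.
  by rewrite iotaDl addn0 => /(perm_map_inj (@addnI _)).
have ew : rcons u m ++ n :: t = opU s t.
  rewrite /opU -us cat_rcons em ss; congr (_ ++ [:: _, _ & _]).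
  by move: sw; rewrite size_cat size_rcons /=; lia.
exists s, t; split => //.
by have := mw; rewrite ew motzkin_word_opU // => /andP[].
Qed.

(** * Listing the Motzkin words *)

(** [m] bounds the nesting of building steps, not the length: longer words may occur too. This keeps
    the recursion for [gf] exact. *)
Fixpoint motzkin_words (m : nat) : seq (seq nat) :=
  if m is m'.+1 then
    [::] :: map opH (motzkin_words m') ++ [seq opU s t | s <- motzkin_words m', t <- motzkin_words m']
  else [:: [::]].

Lemma motzkin_words_ind (P : seq nat -> Prop) :
    P [::] ->
    (forall t, is_perm_word t -> motzkin_word t -> P t -> P (opH t)) ->
    (forall s t, is_perm_word s -> motzkin_word s -> is_perm_word t -> motzkin_word t ->
       P s -> P t -> P (opU s t)) ->
  forall m w, w \in motzkin_words m -> [/\ is_perm_word w, motzkin_word w & P w].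
Proof.
move=> P0 PH PU; elim=> [|m IHm] w; first by rewrite inE => /eqP->.
rewrite inE => /orP[/eqP->|]; first by [].
rewrite mem_cat => /orP[/mapP[t /IHm[pt mt Pt] ->]|].
  by split; [exact: is_perm_word_opH | rewrite motzkin_word_opH | exact: PH].
case/allpairsP => [[s t] [/IHm[ps ms Ps] /IHm[pt mt Pt] ->]] /=.
split; [exact: is_perm_word_opU | | exact: PU].
by rewrite motzkin_word_opU // ms mt.
Qed.

Lemma motzkin_words_perm m w : w \in motzkin_words m -> is_perm_word w.
Proof. by case/(motzkin_words_ind (fun=> True)). Qed.

Lemma mem_motzkin_words m w : size w <= m -> (w \in motzkin_words m) = is_perm_word w && motzkin_word w.
Proof.
move=> wm; apply/idP/idP; first by case/(motzkin_words_ind (fun=> True)) => // -> ->.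
case/andP; elim: m w wm => [|m IHm] w wm pw mw.
  by move: wm; rewrite leqn0 => /nilP->.
have [-> //|[t e [pt mt]]|[s [t [e [ps pt ms mt]]]]] := motzkin_word_cases w pw mw.
  move: wm; rewrite e size_opH ltnS inE mem_cat => tm.
  by rewrite map_f ?orbT // IHm.
move: wm; rewrite e size_opU ltnS inE mem_cat => tm.
rewrite orbA; apply/orP; right; apply: allpairs_f; apply: IHm => //.
  by apply: leq_trans (ltnW tm); exact: leq_addr.
by apply: leq_trans (ltnW tm); exact: leq_addl.
Qed.

Lemma cat_cons_inj (T : eqType) (x : T) u v u' v' :
  x \notin u -> x \notin u' -> u ++ x :: v = u' ++ x :: v' -> u = u' /\ v = v'.
Proof.
elim: u u' => [|y u IHu] [|y' u'] //=; rewrite ?inE ?negb_or.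
- by move=> _ _ [->].
- by move=> _ /andP[xy' _] [e]; rewrite e eqxx in xy'.
- by move=> /andP[xy' _] _ [e]; rewrite e eqxx in xy'.
move=> /andP[_ xu] /andP[_ xu'] [-> /IHu[]] // -> ->.
by [].
Qed.

Lemma opU_inj s t s' t' : is_perm_word s -> is_perm_word s' ->
  opU s t = opU s' t' -> s = s' /\ t = t'.
Proof.
move=> /is_perm_word_lt ps /is_perm_word_lt ps' e.
have := congr1 size e; rewrite !size_opU => -[en].
have := e; rewrite /opU -(cat_rcons (size t)) -(cat_rcons (size t')) en => /cat_cons_inj[||+ et].
- rewrite -en mem_rcons inE negb_or; apply/andP; split; first by lia.
  by apply/negP => /mapP[y /(allP ps)]; lia.
- rewrite mem_rcons inE negb_or; apply/andP; split; first by lia.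
  by apply/negP => /mapP[y /(allP ps')]; lia.
by rewrite et => /rcons_inj[/(inj_map (@addnI _)) ->].
Qed.

Lemma opH_neq_opU t s t' : is_perm_word s -> opH t <> opU s t'.
Proof.
move=> /is_perm_word_lt ps e; have := congr1 size e.
have := congr1 (head 0) e; rewrite size_opH size_opU /opU.
by case: s ps {e} => [|x s] /=; lia.
Qed.

Lemma motzkin_words_uniq m : uniq (motzkin_words m).
Proof.
elim: m => //= m IHm; apply/andP; split.
  rewrite mem_cat negb_or; apply/andP; split; first by apply/negP => /mapP[].
  by apply/negP => /allpairsP[[s t] [_ _ /(congr1 size)]]; rewrite size_opU.
rewrite cat_uniq map_inj_uniq ?IHm /=; last by move=> s t [].
apply/andP; split.
  apply/hasPn => w /allpairsP[[s t] [/= /motzkin_words_perm ps _ ->]].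
  by apply/negP => /mapP[t' _ /esym]; apply: opH_neq_opU.
apply: allpairs_uniq => // -[s t] [s' t'] /allpairsP[[a b] [/= /motzkin_words_perm ? _ [-> _]]].
by move=> /allpairsP[[a' b'] [/= /motzkin_words_perm ? _ [-> _]]] /opU_inj[] // -> ->.
Qed.

(** [occ 0] is the number of nodes of the forest, as each operation adds one node. *)
Lemma occ_eq0 m w : w \in motzkin_words m -> occ 0 w = 0 -> w = [::].
Proof.
case/(motzkin_words_ind (fun w => occ 0 w = 0 -> w = [::])) => //.
- by move=> t pt _ _; rewrite occ_opH0.
- by move=> s t ps _ pt _ _ _; rewrite occ_opU0.
Qed.

(* In the forest encoding of a word by [opH] and [opU], [occ j] is the sum of
   binomials C(depth, j) over the nodes: a node of depth j + 1 contributes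
   j + 1, and its ancestor of depth j one more. *)
Lemma occ_gap m w : w \in motzkin_words m -> forall j, 0 < occ j.+1 w -> j.+2 <= occ j w.
Proof.
case/(motzkin_words_ind (fun w => forall j, 0 < occ j.+1 w -> j.+2 <= occ j w)) => //.
- move=> t pt _ IHt [|j]; rewrite occ_opHS // ?occ_opH0 // ?occ_opHS //.
  + by move/IHt; lia.
  + by move/IHt.
move=> s t ps _ pt _ IHs IHt [|j]; rewrite occ_opUS // ?occ_opU0 // ?occ_opUS //.
  by have := IHs 0; have := IHt 0; lia.
by have := IHs j; have := IHs j.+1; have := IHt j.+1; lia.
Qed.

End Words.

(** * From permutations to words *)

Section PermutationWords.
Local Open Scope nat_scope.

Lemma motzkin_wordP (w : seq nat) :
  reflect ((forall i j l, i < j -> j < l -> l < size w ->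
              ~~ (nth 0 w i < nth 0 w l < nth 0 w j)) /\
           (forall a b, a < b -> b.+1 < size w ->
              ~~ (nth 0 w a < nth 0 w b < nth 0 w b.+1)))
    (motzkin_word w).
Proof.
elim: w => [|x w IHw]; first by left; split.
rewrite motzkin_word_cons; apply: (iffP and3P).
  case=> /IHw[h132 h123] /(pairwiseP 0) pw /(sortedP 0) sw; split.
    move=> [|i] [|j] [|l] //= ij jl lw; last by apply: h132.
    by apply: pw; rewrite ?inE //; lia.
  by move=> [|a] [|b] //= ab bw; [apply: sw; lia | apply: h123].
case=> h132 h123; split.
- apply/IHw; split=> [i j l ij jl lw|a b ab bw].
    exact: (h132 i.+1 j.+1 l.+1).
  exact: (h123 a.+1 b.+1).
- apply/(pairwiseP 0) => j l; rewrite !inE => jw lw jl.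
  exact: (h132 0 j.+1 l.+1).
- apply/(sortedP 0) => b bw; exact: (h123 0 b.+1).
Qed.

Definition word (n : nat) (s : 'S_n) : seq nat := [seq val (s i) | i <- enum 'I_n].

Lemma size_word n (s : 'S_n) : size (word n s) = n.
Proof. by rewrite size_map size_enum_ord. Qed.

Lemma nth_word n (s : 'S_n) (i : 'I_n) : nth 0 (word n s) i = s i.
Proof. by rewrite (nth_map i) ?size_enum_ord // nth_ord_enum. Qed.

Lemma is_perm_word_word n (s : 'S_n) : is_perm_word (word n s).
Proof.
rewrite /is_perm_word size_word; apply: uniq_perm; last 1 first.
- move=> y; rewrite mem_iota add0n; apply/mapP/idP => [[i _ ->]|yn]; first exact: ltn_ord.
  by exists ((s^-1)%g (Ordinal yn)); rewrite ?mem_enum // permKV.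
- by rewrite map_inj_uniq ?enum_uniq // => i j /val_inj/perm_inj.
- exact: iota_uniq.
Qed.

Lemma word_inj n : injective (word n).
Proof. by move=> s s' e; apply/permP => i; apply/val_inj; rewrite /= -!nth_word e. Qed.

Lemma word_surj n w : is_perm_word w -> size w = n -> exists s : 'S_n, word n s = w.
Proof.
move=> pw sw.
have wn (i : 'I_n) : nth 0 w i < n.
  by rewrite -[X in _ < X]sw; apply: (allP (is_perm_word_lt _ pw)); rewrite mem_nth ?sw.
have finj : injective (fun i => Ordinal (wn i)).
  move=> i j [/eqP]; rewrite nth_uniq ?sw //; last by rewrite (perm_uniq pw) iota_uniq.
  by move/eqP/val_inj.
exists (perm finj); apply: (@eq_from_nth _ 0); rewrite size_word ?sw // => i ltin.
by rewrite (nth_word n _ (Ordinal ltin)) permE.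
Qed.

Lemma motzkin_word_word n (s : 'S_n) : motzkin_word (word n s) = motzkin_perm s.
Proof.
apply/motzkin_wordP/andP => -[h132 h123]; split.
- apply/negP => /existsP[i /existsP[j /existsP[l /and4P[ij jl sil slj]]]].
  have := h132 i j l ij jl; rewrite size_word !nth_word => /(_ (ltn_ord l)).
  by rewrite sil slj.
- apply/negP => /existsP[a /existsP[b /existsP[c /and4P[ab /eqP cb sab sbc]]]].
  have := h123 a b ab; rewrite size_word -cb !nth_word => /(_ (ltn_ord c)).
  by rewrite sab sbc.
- move=> i j l ij jl; rewrite size_word => ln.
  apply/negP => /andP[il lj]; case/negP: h132.
  apply/existsP; exists (Ordinal (ltn_trans ij (ltn_trans jl ln))).
  apply/existsP; exists (Ordinal (ltn_trans jl ln)).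
  by apply/existsP; exists (Ordinal ln); rewrite ij jl -!nth_word il lj.
- move=> a b ab; rewrite size_word => bn.
  apply/negP => /andP[sab sbc]; case/negP: h123.
  apply/existsP; exists (Ordinal (ltn_trans ab (ltnW bn))).
  apply/existsP; exists (Ordinal (ltnW bn)).
  by apply/existsP; exists (Ordinal bn); rewrite ab eqxx -!nth_word sab sbc.
Qed.

(** * Occurrences as sums over positions *)

Lemma incS_sum j a w :
  inc j.+1 a w = \sum_(0 <= i < size w) (a < nth 0 w i) * inc j (nth 0 w i) (drop i.+1 w).
Proof.
elim: w => [|x w IHw]; first by rewrite big_nil.
by rewrite incS IHw /= big_nat_recl //= drop0 addnC.
Qed.

Lemma incS_drop_sum j a m w : inc j.+1 a (drop m w) =
  \sum_(0 <= i < size w | m <= i) (a < nth 0 w i) * inc j (nth 0 w i) (drop i.+1 w).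
Proof.
elim: m w => [|m IHm] [|x w].
- by rewrite big_nil.
- by rewrite drop0 incS_sum.
- by rewrite big_nil.
by rewrite drop_cons IHm [RHS]big_mkcond /= big_nat_recl // add0n big_mkcond.
Qed.

Lemma occ_sum j w : occ j w = \sum_(0 <= i < size w)
  (nth 0 w i.+1 <= nth 0 w i) * inc j (nth 0 w i) (drop i.+1 w).
Proof.
elim: w => [|x w IHw]; first by rewrite big_nil.
by rewrite /= IHw big_nat_recl //= drop0 addnC nth0.
Qed.

Lemma sum_tuple_cons (T : finType) j (F : j.+1.-tuple T -> nat) :
  \sum_t F t = \sum_i \sum_(u : j.-tuple T) F [tuple of i :: u].
Proof.
rewrite pair_big /=.
rewrite (reindex (fun p : T * j.-tuple T => [tuple of p.1 :: p.2])) //=.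
exists (fun t : j.+1.-tuple T => (thead t, [tuple of behead t])) => [[i u] _|t _] /=.
  by congr (_, _); apply: val_inj.
by rewrite -tuple_eta.
Qed.

Lemma sum_inc_tuples n (s : 'S_n) j (p : 'I_n) (v : nat) :
  \sum_(u : j.-tuple 'I_n)
     (path ltn p (map val u) && path ltn v [seq val (s l) | l <- u] : nat)
  = inc j v (drop p.+1 (word n s)).
Proof.
elim: j p v => [|j IHj] p v.
  rewrite (eq_bigr (fun=> 1)) => [|u _]; last by rewrite tuple0.
  by rewrite sum_nat_const card_tuple inc0.
rewrite sum_tuple_cons incS_drop_sum size_word big_mkord [RHS]big_mkcond.
apply: eq_bigr => i _; rewrite nth_word -IHj.
under eq_bigr => u _ do rewrite /= andbACA.
case: ltnP => pi /=; last by rewrite big1.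
by case: ltnP => vi /=; [rewrite mul1n | rewrite big1].
Qed.

Lemma num_occurrences_word j n (s : 'S_n) :
  num_occurrences j.+3 s = occ j.+1 (word n s).
Proof.
rewrite /num_occurrences -sum1dep_card big_mkcond /= sum_tuple_cons.
rewrite occ_sum size_word big_mkord; apply: eq_bigr => a _.
rewrite sum_tuple_cons nth_word.
transitivity (\sum_(b < n) ((b == a.+1 :> nat) && (s b < s a)) *
    inc j.+1 (s a) (drop b.+1 (word n s))).
  apply: eq_bigr => b _; rewrite -sum_inc_tuples big_distrr /=.
  apply: eq_bigr => u _; rewrite /occurrence /=.
  case: (b == _ :> nat) => //=; rewrite andbCA.
  by case: (s b < s a) => /=; rewrite ?mul0n ?mul1n //; case: (_ && _).
(* The last position, a descent top by the convention in [occ], contributes nothing, since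
   [inc j.+1] vanishes on the empty word. *)
have [an|an] := ltnP a.+1 n; last first.
  rewrite big1 => [|b _]; first by rewrite drop_oversize ?size_word ?muln0.
  by case: eqP => // ba; have := ltn_ord b; rewrite ba ltnNge an.
rewrite (bigD1 (Ordinal an)) //= eqxx big1 ?addn0 => [|b /eqP ba]; last first.
  by case: eqP => // e; case: ba; apply: val_inj.
have e : nth 0 (word n s) a.+1 = s (Ordinal an) by rewrite -nth_word.
(* At a descent, the letter at [a.+1] is below [s a], so [inc] does not see whether it is
   dropped. *)
rewrite e [drop a.+1 _](drop_nth 0) ?size_word // e incS.
have -> : (s (Ordinal an) <= s a) = (s (Ordinal an) < s a).
  rewrite leq_eqVlt; case: eqP => // /val_inj/perm_inj/(congr1 val) /= sa.
  by exfalso; lia.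
case: ltnP => //= lt; rewrite ltnNge (ltnW lt) /=; lia.
Qed.

Lemma motzkin_count_words j n r m : n <= m ->
  motzkin_count j.+3 n r =
    count (fun w => (size w == n) && (occ j.+1 w == r)) (motzkin_words m).
Proof.
move=> nm; rewrite /motzkin_count cardE -(size_map (word n)) -size_filter.
apply: perm_size; apply: uniq_perm.
- by rewrite map_inj_uniq ?enum_uniq //; apply: word_inj.
- by rewrite filter_uniq ?motzkin_words_uniq.
move=> w; rewrite mem_filter; apply/mapP/idP => [[s + ->]|].
  rewrite mem_enum inE -motzkin_word_word num_occurrences_word => /andP[ms ->].
  by rewrite size_word eqxx mem_motzkin_words ?size_word // is_perm_word_word.
case/andP => /andP[/eqP sw /eqP ow]; rewrite mem_motzkin_words ?sw // => /andP[pw mw].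
have [s es] := word_surj n w pw sw.
by exists s; rewrite // mem_enum inE -motzkin_word_word num_occurrences_word es mw ow eqxx.
Qed.

End PermutationWords.

(** * Generating functions *)

(* Both marking variables live in [{poly {poly rat}}]: the outer ['X] is q and
   the inner one, [xx], is x. *)
Definition xx : {poly {poly rat}} := ('X)%:P.

(** Keeps the forests of depth at most [j]; on these, q counts the nodes of depth [j]. *)
Definition weight (j : nat) (w : seq nat) : {poly {poly rat}} :=
  if occ j.+1 w == 0%N then 'X ^+ occ j w * xx ^+ size w else 0.

Definition gf (m j : nat) := \sum_(w <- motzkin_words m) weight j w.

Lemma gf0 j : gf 0 j = 1.
Proof. by rewrite /gf big_seq1 /weight /= expr0 mul1r. Qed.

Lemma gfS m j : gf m.+1 j = 1 + \sum_(t <- motzkin_words m) weight j (opH t)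
  + \sum_(s <- motzkin_words m) \sum_(t <- motzkin_words m) weight j (opU s t).
Proof.
rewrite /gf /= big_cons big_cat big_map big_allpairs_dep addrA.
by rewrite /weight /= expr0 mul1r.
Qed.

Lemma nil_motzkin_words m : [::] \in motzkin_words m.
Proof. by rewrite mem_motzkin_words. Qed.

(** A nonempty [s] would create nodes of depth 1, which the weight excludes; so only [s = [::]]
    survives in [opU], and each new root carries q. *)
Lemma gfS0 m : gf m.+1 0 = 1 + 'X * (xx + xx ^+ 2) * gf m 0.
Proof.
rewrite gfS mulrDr mulrDl addrA; congr (1 + _ + _); rewrite /gf mulr_sumr.
  rewrite big_seq [RHS]big_seq; apply: eq_bigr => t /motzkin_words_perm pt.
  rewrite /weight occ_opHS // occ_opH0 // size_opH; case: ifP => _.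
    by rewrite !exprS; ring.
  by rewrite mulr0.
rewrite (bigD1_seq [::]) ?nil_motzkin_words ?motzkin_words_uniq //= [X in _ + X]big_seq_cond.
rewrite [X in _ + X]big1 ?addr0 => [|s /andP[sW s0]].
  rewrite big_seq [RHS]big_seq; apply: eq_bigr => t /motzkin_words_perm pt.
  rewrite /weight occ_opUS // occ_opU0 // size_opU /= !add0n; case: ifP => _.
    by rewrite !exprS; ring.
  by rewrite mulr0.
rewrite big_seq big1 // => t /motzkin_words_perm pt.
rewrite /weight occ_opUS ?(motzkin_words_perm m s sW) //; case: eqP => // e.
case/eqP: s0; apply: occ_eq0 sW _; lia.
Qed.

(** Placing [s] under a root raises its depths by one, so it is weighted at level [j], while [t]
    stays at level [j.+1]. *)
Lemma gfSS m j : gf m.+1 j.+1 =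
  1 + xx * gf m j.+1 + xx ^+ 2 * gf m j * gf m j.+1.
Proof.
rewrite gfS; congr (1 + _ + _); rewrite /gf.
  rewrite mulr_sumr big_seq [RHS]big_seq; apply: eq_bigr => t /motzkin_words_perm pt.
  rewrite /weight !occ_opHS // size_opH; case: ifP => _.
    by rewrite !exprS; ring.
  by rewrite mulr0.
rewrite -mulrA mulr_suml mulr_sumr big_seq [RHS]big_seq; apply: eq_bigr => s sW.
rewrite !mulr_sumr big_seq [RHS]big_seq; apply: eq_bigr => t /motzkin_words_perm pt.
have ps := motzkin_words_perm m s sW.
rewrite /weight !occ_opUS // size_opU.
(* Level [j] asks of [s] only that [occ j.+1] vanish; by the gap, [occ j.+2] then vanishes as
   well. *)
have := occ_gap m s sW j.+1.
case: (posnP (occ j.+2 s)) => [-> _|_ /(_ isT) os]; last first.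
  have /negPf os0 : occ j.+1 s != 0%N by rewrite -lt0n (leq_trans _ os).
  by rewrite !addn_eq0 os0 andbF mul0r mulr0.
case: (eqVneq (occ j.+1 s) 0%N) => [->|os]; last first.
  by rewrite add0n addn_eq0 (negPf os) mul0r mulr0.
rewrite !add0n; case: ifP => _; last by rewrite !mulr0.
by rewrite !exprD !exprS exprD; ring.
Qed.

(** Each recursive call comes with a factor x, so one more level only changes degrees above [m]. The
    equations of the continued fraction thus hold for [gf m] modulo x^(m+1). *)
Lemma gf_stable m j : exists s, gf m.+1 j = gf m j + xx ^+ m.+1 * s.
Proof.
elim: m j => [|m IHm] j.
  rewrite gf0; case: j => [|j].
    by exists ('X * (1 + xx)); rewrite gfS0 gf0; ring.
  by exists (1 + xx); rewrite gfSS !gf0; ring.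
case: j => [|j].
  have [s es] := IHm 0%N; exists ('X * (1 + xx) * s).
  by rewrite gfS0 [in RHS]gfS0 es !exprS; ring.
have [s es] := IHm j.+1; have [u eu] := IHm j.
exists (s + xx * gf m j * s + xx * u * gf m j.+1 + xx * (u * s * xx ^+ m.+1)).
by rewrite gfSS [in RHS]gfSS es eu !exprS; ring.
Qed.

(** * Convergents of the continued fraction *)

(* [chebV m] is x^m U_m((1-x)/(2x)) and [chebD m] is chebV m - x^2 chebV (m-1),
   that is, x^m (U_m - x U_(m-1)) at (1-x)/(2x). *)
Fixpoint chebV (m : nat) : {poly rat} :=
  match m with
  | 0 => 1
  | 1 => 1 - 'X
  | (m1.+1 as m2).+1 => (1 - 'X) * chebV m2 - 'X ^+ 2 * chebV m1
  end.

Definition chebD (m : nat) : {poly rat} :=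
  if m is m'.+1 then chebV m - 'X ^+ 2 * chebV m' else 1.

Lemma chebVSS m : chebV m.+2 = (1 - 'X) * chebV m.+1 - 'X ^+ 2 * chebV m.
Proof. by []. Qed.

Lemma chebDSS m : chebD m.+2 = (1 - 'X) * chebD m.+1 - 'X ^+ 2 * chebD m.
Proof. by case: m => [|m]; rewrite /chebD ?chebVSS /=; ring. Qed.

(** A Casoratian: both sequences satisfy the same recurrence, so each step multiplies it by x^2. *)
Lemma chebVD_det m :
  chebV m.+1 * chebD m - chebV m * chebD m.+1 = 'X ^+ (2 * m.+1).
Proof.
elim: m => [|m IHm]; first by rewrite /=; ring.
rewrite [in RHS]mulnS exprD -IHm chebVSS chebDSS; ring.
Qed.

(* 1 / G_0 for j = 0, and the denominator of the j-th convergent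
   G_j = gfden (j-1) / gfden j of the continued fraction. *)
Definition gfden (j : nat) : {poly {poly rat}} :=
  (chebD j)%:P - 'X * (('X + 'X ^+ 2) * chebV j)%:P.

Lemma gfdenSS j : gfden j.+2 = (1 - xx) * gfden j.+1 - xx ^+ 2 * gfden j.
Proof.
rewrite /gfden chebVSS chebDSS /xx !(polyCM, polyCB, polyCD, polyC1, polyCN, polyC_exp).
ring.
Qed.

Lemma gfden0 : gfden 0 = 1 - 'X * (xx + xx ^+ 2).
Proof. by rewrite /gfden /xx /= mulr1 polyCD polyC_exp. Qed.

(** The recurrence of [gfdenSS] with 1, the numerator of G_0, at index -1. *)
Lemma gfden1 : gfden 1 = (1 - xx) * gfden 0 - xx ^+ 2.
Proof.
rewrite gfden0 /gfden /chebD /= /xx !(polyCM, polyCB, polyCD, polyC1, polyCN, polyC_exp).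
ring.
Qed.

Lemma gf_den0 m : exists s, gfden 0 * gf m 0 = 1 + xx ^+ m.+1 * s.
Proof.
have [s es] := gf_stable m 0; exists (- s).
have := gfS0 m; rewrite es gfden0 => e.
rewrite mulrBl mul1r -[X in X - _](addrK (xx ^+ m.+1 * s)) e; ring.
Qed.

(** The equation for G_(j+1), multiplied by [gfden j], contains [gfden j * gf m j], known from the
    level below; the recurrence of [gfden] collects the rest. *)
Lemma gf_den m j : exists s,
  gfden j.+1 * gf m j.+1 = gfden j + xx ^+ m.+1 * s.
Proof.
elim: j => [|j [u eu]].
  have [u eu] := gf_den0 m; have [s es] := gf_stable m 1.
  exists (xx ^+ 2 * gf m 1 * u - gfden 0 * s).
  have e : gf m 1 = 1 + xx * gf m 1 + xx ^+ 2 * gf m 0 * gf m 1 - xx ^+ m.+1 * s.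
    by rewrite -gfSS es addrK.
  have e2 : gfden 0 * gf m 1 * (1 - xx) = gfden 0
      + xx ^+ 2 * (gfden 0 * gf m 0) * gf m 1 - xx ^+ m.+1 * s * gfden 0.
    by rewrite mulrBr mulr1 [in X in X - _]e; ring.
  transitivity (gfden 0 * gf m 1 * (1 - xx) - xx ^+ 2 * gf m 1).
    by rewrite gfden1; ring.
  by rewrite e2 eu; ring.
have [s es] := gf_stable m j.+2.
exists (xx ^+ 2 * gf m j.+2 * u - gfden j.+1 * s).
have e : gf m j.+2 = 1 + xx * gf m j.+2 + xx ^+ 2 * gf m j.+1 * gf m j.+2 - xx ^+ m.+1 * s.
  by rewrite -gfSS es addrK.
have e2 : gfden j.+1 * gf m j.+2 * (1 - xx) = gfden j.+1
    + xx ^+ 2 * (gfden j.+1 * gf m j.+1) * gf m j.+2 - xx ^+ m.+1 * s * gfden j.+1.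
  by rewrite mulrBr mulr1 [in X in X - _]e; ring.
transitivity (gfden j.+1 * gf m j.+2 * (1 - xx) - xx ^+ 2 * gfden j * gf m j.+2).
  by rewrite gfdenSS; ring.
by rewrite e2 eu; ring.
Qed.

(** * Coefficients of the powers of q *)

Lemma coef_gf m j r n : (r <= j.+1)%N -> (gf m j)`_r`_n =
  (count (fun w => (size w == n) && (occ j w == r)) (motzkin_words m))%:R.
Proof.
move=> rj; rewrite /gf !coef_sum -sum1_count natr_sum [RHS]big_mkcond /=.
rewrite big_seq [RHS]big_seq; apply: eq_bigr => w wW.
rewrite /weight /xx -polyC_exp; case: eqP => [_|/eqP ow].
  rewrite coefMC coefXn [r == _]eq_sym.
  case: (occ j w == r) => /=; rewrite ?mul1r ?mul0r ?andbF ?coef0 //.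
  by rewrite andbT coefXn eq_sym; case: eqP.
(* A word discarded by the weight has [occ j] at least [j.+2], hence different from [r]. *)
rewrite !coef0; case: ifP => // /andP[_ /eqP or]; exfalso.
by have := occ_gap m w wW j; lia.
Qed.

Lemma coef_gfden_gf0 m j : exists s,
  chebD j.+1 * (gf m j.+1)`_0 = chebD j + 'X ^+ m.+1 * s.
Proof.
have [s es] := gf_den m j; exists s`_0.
have := congr1 (fun p : {poly {poly rat}} => p`_0) es.
rewrite /gfden mulrBl -mulrA /xx -polyC_exp !(coefB, coefD, coefCM, coefXM, coefC) /=.
by rewrite !subr0.
Qed.

(** [gfden] is linear in q, so [gf_den] gives a first-order recurrence in [r]; the q-term of
    [gfden j] enters only at [r = 0]. *)
Lemma coef_gfden_gfS m j r : exists s,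
  chebD j.+1 * (gf m j.+1)`_r.+1 = ('X + 'X ^+ 2) *
    (chebV j.+1 * (gf m j.+1)`_r - (if r == 0%N then chebV j else 0)) + 'X ^+ m.+1 * s.
Proof.
have [s es] := gf_den m j; exists s`_r.+1.
have := congr1 (fun p : {poly {poly rat}} => p`_r.+1) es.
rewrite /gfden mulrBl -mulrA /xx -polyC_exp !(coefB, coefD, coefCM, coefXM, coefC) /=.
move=> /eqP; rewrite subr_eq => /eqP ->.
by case: (r == 0%N); ring.
Qed.

(** The determinant evaluates the coefficient of q; every further power of q brings a factor (x +
    x^2) V_(j+1) / D_(j+1). *)
Lemma gf_pow_den m j r : exists s,
  chebD j.+1 ^+ r.+2 * (gf m j.+1)`_r.+1 =
  ('X + 'X ^+ 2) ^+ r.+1 * chebV j.+1 ^+ r * 'X ^+ (2 * j.+1) + 'X ^+ m.+1 * s.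
Proof.
elim: r => [|r [u eu]].
  have [s es] := coef_gfden_gfS m j 0; have [u eu] := coef_gfden_gf0 m j.
  exists (('X + 'X ^+ 2) * chebV j.+1 * u + chebD j.+1 * s).
  rewrite -(chebVD_det j) expr2 -mulrA es eqxx.
  transitivity (('X + 'X ^+ 2) * (chebV j.+1 * (chebD j.+1 * (gf m j.+1)`_0)
     - chebD j.+1 * chebV j) + chebD j.+1 * ('X ^+ m.+1 * s)); first by ring.
  by rewrite eu; ring.
have [s es] := coef_gfden_gfS m j r.+1.
exists (('X + 'X ^+ 2) * chebV j.+1 * u + chebD j.+1 ^+ r.+2 * s).
rewrite exprSr -mulrA es (_ : (r.+1 == 0)%N = false) // subr0.
transitivity (('X + 'X ^+ 2) * chebV j.+1 * (chebD j.+1 ^+ r.+2 * (gf m j.+1)`_r.+1)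
   + chebD j.+1 ^+ r.+2 * ('X ^+ m.+1 * s)); first by ring.
by rewrite eu !exprS; ring.
Qed.

Lemma chebD_at0 j : (chebD j).[0] = 1.
Proof.
have V0 : forall i, (chebV i).[0] = 1.
  case=> [|i]; first by rewrite /= hornerE.
  by elim: i => [|i IHi]; rewrite ?chebVSS !hornerE ?IHi /=; ring.
case: j => [|j]; first by rewrite /= hornerE.
by rewrite /chebD !hornerE V0; ring.
Qed.

Lemma motzkin_series j r (P : {poly rat}) : (r <= j.+2)%N ->
    (forall m, exists s,
       chebD j.+1 ^+ r.+1 * (gf m j.+1)`_r = P + 'X ^+ m.+1 * s) ->
  series_expansion (tofrac P / tofrac (chebD j.+1 ^+ r.+1))
    (fun n => (motzkin_count j.+3 n r)%:R).
Proof.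
move=> rj hP; exists P, (chebD j.+1 ^+ r.+1); split=> // [|n].
  by rewrite -horner_coef0 horner_exp chebD_at0 expr1n oner_eq0.
(* With [m = n] the error term starts beyond degree [n], and the list holds all words of length at
   most [n]. *)
have [s /(congr1 (fun p : {poly rat} => p`_n))] := hP n.
rewrite coefM coefD coefXnM ltnSn addr0 => <-.
apply: eq_bigr => i _; rewrite coef_gf // (motzkin_count_words j _ _ n) //.
exact: leq_subr.
Qed.

(** * Return to the Chebyshev polynomials *)

Lemma ratx_neq0 : ratx != 0.
Proof. by rewrite /ratx tofrac_eq0 polyX_eq0. Qed.

Lemma chebU_natSS (F : fieldType) (x : F) (m : nat) :
    x != 0 -> 2%:R != 0 :> F ->
  (chebU_nat F m.+2).[(1 - x) / (2%:R * x)] =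
  (1 - x) / x * (chebU_nat F m.+1).[(1 - x) / (2%:R * x)]
    - (chebU_nat F m).[(1 - x) / (2%:R * x)].
Proof.
move=> x0 two_neq0; rewrite [chebU_nat F m.+2]/= -/(chebU_nat F m.+1).
rewrite hornerD hornerN hornerM hornerMn hornerX; congr (_ * _ - _).
by rewrite -mulr_natl; field; rewrite x0.
Qed.

Lemma chebU_nat_chebV (F : fieldType) (x : F) (f : {rmorphism {poly rat} -> F})
    (m : nat) :
    x != 0 -> 2%:R != 0 :> F -> f 'X = x ->
  x ^+ m * (chebU_nat F m).[(1 - x) / (2%:R * x)] = f (chebV m).
Proof.
move=> x0 two_neq0 fX; pose z := (1 - x) / (2%:R * x).
suff: x ^+ m * (chebU_nat F m).[z] = f (chebV m) /\
  x ^+ m.+1 * (chebU_nat F m.+1).[z] = f (chebV m.+1) by case.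
elim: m => [|m [IH1 IH2]]; split=> //.
- by rewrite expr0 mul1r hornerC rmorph1.
- rewrite /= hornerMn hornerX rmorphB rmorph1 fX -mulr_natl /z.
  by field; rewrite x0.
rewrite chebU_natSS // chebVSS rmorphB !rmorphM rmorphB rmorph1 fX -IH1 -IH2 -/z.
by rewrite !exprS; field.
Qed.

Lemma chebUxV j : ratx ^+ j * chebUx j%:Z = tofrac (chebV j).
Proof.
apply: chebU_nat_chebV => //; first exact: ratx_neq0.
by rewrite -(rmorph_nat (@tofrac {poly rat})) tofrac_eq0 -polyC_natr polyC_eq0.
Qed.

Lemma mulr_expB (R : comNzRingType) (x a b : R) (m : nat) :
  x ^+ m.+1 * (a - x * b) = x ^+ m.+1 * a - x ^+ 2 * (x ^+ m * b).
Proof. by rewrite !exprS; ring. Qed.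

Lemma chebUxD j :
  ratx ^+ j * (chebUx j%:Z - ratx * chebUx (j%:Z - 1)) = tofrac (chebD j).
Proof.
case: j => [|j].
  (* U_(-1) = 0 matches [chebD 0 = 1]; this serves the case k = 3. *)
  have -> : Posz 0 - 1 = Negz 0 by [].
  have -> : chebUx (Negz 0) = 0 := horner0 _.
  by rewrite mulr0 subr0; exact: chebUxV.
have -> : Posz j.+1 - 1 = Posz j by rewrite -addn1 PoszD addrK.
by rewrite /chebD tofracB tofracM tofracXn -!chebUxV mulr_expB.
Qed.

Lemma chebD_neq0 j : chebD j != 0.
Proof. by apply: contraTneq (oner_neq0 rat) => e; rewrite -(chebD_at0 j) e horner0 eqxx. Qed.

Lemma scale_frac0 (F : fieldType) (x a b : F) (m : nat) : x != 0 -> b != 0 ->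
  a / (x * b) = x ^+ m * a / (x ^+ m.+1 * b).
Proof.
by move=> x0 b0; rewrite exprS; field; rewrite b0 x0 expf_neq0.
Qed.

(** Numerator and denominator are scaled by x^(m(r+2)): x^(mr) goes to the powers of [u], and x^(2m)
    is the determinant when [m = j.+1]. *)
Lemma scale_fracS (F : fieldType) (x u b : F) (m r : nat) : x != 0 -> b != 0 ->
  x ^+ r.+1 * (1 + x) ^+ r.+1 * u ^+ r / b ^+ r.+2 =
  (x + x ^+ 2) ^+ r.+1 * (x ^+ m * u) ^+ r * x ^+ (2 * m) / (x ^+ m * b) ^+ r.+2.
Proof.
move=> x0 b0; rewrite (_ : x + x ^+ 2 = x * (1 + x)); last by ring.
rewrite mul2n -addnn !exprMn exprD !exprS.
have := expf_neq0 r (expf_neq0 m x0); have := expf_neq0 m x0.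
have := expf_neq0 r b0.
move: (b ^+ r) (x ^+ m) => B X B0 X0 Y0.
by field; rewrite b0 B0 X0 Y0.
Qed.

(* For k = 2 the first formula evaluates to 1, whereas the generating function of
   the Motzkin permutations without descents is 1 + x + x^2; hence 3 <= k. *)
Theorem theorem3p14 (k : nat) (hk : (3 <= k)%N) :
  series_expansion
    ((chebUx (k%:Z - 3) - ratx * chebUx (k%:Z - 4))
       / (ratx * (chebUx (k%:Z - 2) - ratx * chebUx (k%:Z - 3))))
    (fun n : nat => (motzkin_count k n 0)%:R)
  /\ forall r : nat, (1 <= r <= k.-1)%N ->
     series_expansion
       (ratx ^+ r * (1 + ratx) ^+ r * chebUx (k%:Z - 2) ^+ r.-1
          / (chebUx (k%:Z - 2) - ratx * chebUx (k%:Z - 3)) ^+ r.+1)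
       (fun n : nat => (motzkin_count k n r)%:R).
Proof.
case: k hk => [|[|[|j]]] // _.
have -> : Posz j.+3 - 4 = Posz j - 1 by lia.
have -> : Posz j.+3 - 3 = Posz j by lia.
have -> : Posz j.+3 - 2 = Posz j.+1 by lia.
have x0 := ratx_neq0.
have := chebUxD j; have := chebUxD j.+1.
have -> : Posz j.+1 - 1 = Posz j by lia.
set a := chebUx j - _; set b := chebUx j.+1 - _ => hb ha.
have b0 : b != 0.
  by apply: contraNneq (chebD_neq0 j.+1) => e; rewrite -tofrac_eq0 -hb e mulr0.
split.
  have -> : a / (ratx * b) = tofrac (chebD j) / tofrac (chebD j.+1 ^+ 1).
    by rewrite expr1 -ha -hb (scale_frac0 _ _ _ _ j).
  by apply: motzkin_series => // m; rewrite expr1; apply: coef_gfden_gf0.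
case=> [|r] // /andP[_ rj].
have -> : ratx ^+ r.+1 * (1 + ratx) ^+ r.+1 * chebUx j.+1 ^+ r / b ^+ r.+2 =
  tofrac (('X + 'X ^+ 2) ^+ r.+1 * chebV j.+1 ^+ r * 'X ^+ (2 * j.+1)) /
  tofrac (chebD j.+1 ^+ r.+2).
  rewrite [tofrac (chebD _ ^+ _)]tofracXn !tofracM !tofracXn tofracD tofracXn -hb -chebUxV.
  exact: scale_fracS.
by apply: motzkin_series => // m; apply: gf_pow_den.
Qed.
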